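(* For every Platonic solid $\{p,q\}$, with $\omega_n:=1+2\cos\frac{2\pi}{n}$, the triples $(b_1,b_2,b_3)\in\mathbb Z[\omega_p,\omega_q]^3$ satisfying the integrality condition $$\sqrt{\Delta_{\{p,q\}}}\in\mathbb Z[\omega_p,\omega_q],\qquad \Delta_{\{p,q\}}:=(1+\omega_q)(b_1b_2+b_2b_3+b_3b_1-\omega_pb_2^2),$$ are given by $(b_1,b_2,b_3)=\frac kg(h_1,h_2,h_3)$, where $$h_1=(1+\omega_q)(t_2+t_3)t_2,\qquad h_2=(1+\omega_q)(t_2+t_3)t_3,\qquad h_3=t_1^2-(1+\omega_q)(t_2-\omega_pt_3)t_3,$$ $t_1,t_2,t_3\in\mathbb Z[\omega_p,\omega_q]$ are coprime, and $k\in\mathbb Z[\omega_p,\omega_q]$ is coprime with $g=\gcd(h_0,h_1,h_2,h_3)$, where $h_0=(1+\omega_q)(t_2+t_3)t_1$.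
   Context: A Platonic solid is denoted by its Schläfli symbol $\{p,q\}$ ($p$-gonal faces, $q$ of which meet at each vertex), so $\{p,q\}\in\{\{3,3\},\{3,4\},\{4,3\},\{3,5\},\{5,3\}\}$. The ring $\mathbb Z[\omega_p,\omega_q]$ is $\mathbb Z$ for $\{3,3\},\{3,4\},\{4,3\}$ and $\mathbb Z[\varphi]$, $\varphi=\frac{1+\sqrt5}2$, for $\{3,5\},\{5,3\}$; it has class number 1, and gcd's (defined up to units) are taken in it. ''$t_1,t_2,t_3$ coprime'' means $\gcd(t_1,t_2,t_3)=1$ (up to units).
   Formalization: ''k coprime with g'' is dropped for general triples (k is arbitrary) and kept only when b1,b2,b3 are coprime: as printed it fails, e.g. {3,3}, b=(2,2,0), Δ=4, which forces t=(±1,±1,±1) with t2=t3, g=2 and k=±2. *)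

(* Defs.v *)
From mathcomp Require Import all_boot all_order all_algebra.
From mathcomp Require Import all_classical all_reals all_analysis.

Set Implicit Arguments.
Unset Strict Implicit.
Unset Printing Implicit Defensive.

Import Order.TTheory GRing.Theory Num.Theory.
Local Open Scope classical_set_scope.
Local Open Scope ring_scope.

Definition platonic_solids : seq (nat * nat) :=
  [:: (3, 3); (3, 4); (4, 3); (3, 5); (5, 3)]%N.

Definition omega (R : realType) (n : nat) : R :=
  1 + 2 * cos (2 * pi / n%:R).

(* Z[a, b] as the smallest subring of R containing a and b. *)
Definition Zadjoin (R : realType) (a b : R) : set R :=
  [set x | forall S : {pred R},
     GRing.subring_closed S -> a \in S -> b \in S -> x \in S].

Definition Zomega (R : realType) (p q : nat) : set R :=
  Zadjoin (omega R p) (omega R q).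

Definition divides_in (R : realType) (A : set R) (d x : R) : Prop :=
  exists2 y, A y & x = d * y.

(* gcd's are only defined up to units of A, whence a relation. *)
Definition is_gcd_in (R : realType) (A : set R) (g : R) (s : seq R) : Prop :=
  [/\ A g,
      forall x, x \in s -> divides_in A g x
    & forall d, A d -> (forall x, x \in s -> divides_in A d x) ->
        divides_in A d g].

Definition coprime_in (R : realType) (A : set R) (s : seq R) : Prop :=
  is_gcd_in A 1 s.

Section Solid.
Variables (R : realType) (p q : nat).
Let wp := omega R p.
Let wq := omega R q.

Definition Delta (b1 b2 b3 : R) : R :=
  (1 + wq) * (b1 * b2 + b2 * b3 + b3 * b1 - wp * b2 ^+ 2).

(* Num.sqrt is 0 on negative numbers, whose square roots are not in the real
   ring Z[omega_p, omega_q]: hence the sign condition. *)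
Definition integrality (b1 b2 b3 : R) : Prop :=
  let A := Zomega p q in
  [/\ A b1, A b2, A b3, 0 <= Delta b1 b2 b3 & A (Num.sqrt (Delta b1 b2 b3))].

Definition h0 (t1 t2 t3 : R) : R := (1 + wq) * (t2 + t3) * t1.
Definition h1 (t1 t2 t3 : R) : R := (1 + wq) * (t2 + t3) * t2.
Definition h2 (t1 t2 t3 : R) : R := (1 + wq) * (t2 + t3) * t3.
Definition h3 (t1 t2 t3 : R) : R :=
  t1 ^+ 2 - (1 + wq) * (t2 - wp * t3) * t3.

(* (b1, b2, b3) = k / g (h1, h2, h3) with t1, t2, t3 coprime and
   g = gcd (h0, h1, h2, h3). *)
Definition given_by (b1 b2 b3 t1 t2 t3 k g : R) : Prop :=
  let A := Zomega p q in
  [/\ [/\ A t1, A t2, A t3 & coprime_in A [:: t1; t2; t3]],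
      A k,
      is_gcd_in A g [:: h0 t1 t2 t3; h1 t1 t2 t3; h2 t1 t2 t3; h3 t1 t2 t3]
    & [/\ b1 = k / g * h1 t1 t2 t3,
          b2 = k / g * h2 t1 t2 t3
        & b3 = k / g * h3 t1 t2 t3]].

End Solid.

(* Pitfall: requiring k to be coprime with g would lose some imprimitive
   triples.  For {3,3} (omega_p = omega_q = 0), (2, 2, 0) has Delta = 4, but
   proportionality forces t = (+-1, 1, 1) up to sign, so that
   (h1, h2, h3) = (2, 2, 0), g = 2 and k = 2 up to sign. *)

(* Main.v *)
Require Import Defs.
From mathcomp Require Import all_boot all_order all_algebra.
From mathcomp Require Import all_classical all_reals all_analysis.
From mathcomp Require Import zify ring lra.
Set Implicit Arguments.
Unset Strict Implicit.
Unset Printing Implicit Defensive.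

Import Order.TTheory GRing.Theory Num.Theory.
Local Open Scope ring_scope.

(** Write [A] for the ring of the solid, [c = 1 + omega_q] and [h] for the
    vector of the [h_i].

    The parametrization rests on the polynomial identity [Delta_h]: at
    [(h1, h2, h3)] the form [Delta] takes the square value [h0 ^ 2]. Hence at
    [k / g * h] its root is [k / g * h0] up to sign, which lies in [A] because
    [g] divides [h0].

    Conversely, geometrically, a solution [(b1, b2, b3)] with root [d] is a
    point of the quadric [Delta b = d ^ 2], and [h] inverts the projection
    [(d, b1, b2, b3) |-> (d : b1 : b2)] from its point [(0, 0, 0, 1)], since
    [h0 : h1 : h2 = t1 : t2 : t3]. So [t] must be [(d, b1, b2)] divided by its
    gcd [e]. Substitution then gives
    [(h0, h1, h2, h3) = lam * (d, b1, b2, b3)] with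
    [lam = c * (b1 + b2) / e ^ 2], whence [g = lam * k] for
    [k = gcd (d, b1, b2, b3)], and [b = k / g * h]
    ([integrality_given_by]). If [b] is coprime, this [k] is a unit, hence
    coprime with [g]. The factor [lam] vanishes only when [b1 + b2 = 0]; then
    [Delta = - c * (1 + omega_p) * b2 ^ 2], which is nonnegative only for
    [b1 = b2 = 0], and [t = (1, 0, 0)] serves ([given_by_degenerate]).

    The arithmetic input is that gcd's exist in [A] and commute with scaling by
    any real number, in particular by [lam] and [1 / e], which need not lie in
    [A]. This follows from Bezout's identity ([homogeneous_gcd]), which holds
    because [A] is Euclidean: it is [Z], or [Z[w]] with [w ^ 2 = w + 1], where
    rounding coordinates gives a division for the norm
    ([golden_division]). *)

(** * Divisibility in a subring of the reals *)

Definition subring_set {R : realType} (A : set R) : Prop :=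
  [/\ A 1, forall x y, A x -> A y -> A (x - y)
    & forall x y, A x -> A y -> A (x * y)].

Section Divisibility.
Variables (R : realType) (A : set R).
Hypothesis subA : subring_set A.

Lemma subring_set1 : A 1. Proof. by case: subA. Qed.

Lemma subring_setB x y : A x -> A y -> A (x - y).
Proof. by case: subA => _ + _; apply. Qed.

Lemma subring_setM x y : A x -> A y -> A (x * y).
Proof. by case: subA => _ _; apply. Qed.

Lemma subring_set0 : A 0.
Proof. by rewrite -(subrr 1); apply: subring_setB; apply: subring_set1. Qed.

Lemma subring_setN x : A x -> A (- x).
Proof. by rewrite -sub0r; apply: subring_setB; apply: subring_set0. Qed.

Lemma subring_setD x y : A x -> A y -> A (x + y).
Proof.
by move=> Ax Ay; rewrite -(opprK y); apply/subring_setB/subring_setN.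
Qed.

Lemma subring_set_int (n : int) : A n%:~R.
Proof.
have natA (m : nat) : A m%:R.
  elim: m => [|m IHm]; first exact: subring_set0.
  by rewrite -natr1; apply: subring_setD => //; apply: subring_set1.
by case: n => m; rewrite ?NegzE ?mulrNz; first exact: natA;
   apply/subring_setN/natA.
Qed.

Lemma divides_in_refl x : divides_in A x x.
Proof. by exists 1; rewrite ?mulr1 //; apply: subring_set1. Qed.

Lemma divides_in0 d : divides_in A d 0.
Proof. by exists 0; rewrite ?mulr0 //; apply: subring_set0. Qed.

Lemma divides_in_trans d x y :
  divides_in A d x -> divides_in A x y -> divides_in A d y.
Proof.
by move=> [u Au ->] [v Av ->]; exists (u * v); rewrite ?mulrA //;
   apply: subring_setM.
Qed.

Lemma divides_inD d x y :
  divides_in A d x -> divides_in A d y -> divides_in A d (x + y).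
Proof.
by move=> [u Au ->] [v Av ->]; exists (u + v); rewrite ?mulrDr //;
   apply: subring_setD.
Qed.

Lemma divides_inM d u x : A u -> divides_in A d x -> divides_in A d (u * x).
Proof.
by move=> Au [v Av ->]; exists (u * v); rewrite 1?mulrCA //;
   apply: subring_setM.
Qed.

Lemma divides_in_mul2l c d x :
  divides_in A d x -> divides_in A (c * d) (c * x).
Proof. by move=> [u Au ->]; exists u; rewrite ?mulrA. Qed.

Lemma divides_in1 x : A x -> divides_in A 1 x.
Proof. by move=> Ax; exists x; rewrite ?mul1r. Qed.

Lemma divides_in_closed d x : A d -> divides_in A d x -> A x.
Proof. by move=> Ad [u Au ->]; apply: subring_setM. Qed.

Definition bezout_in : Prop := forall x y, A x -> A y ->
  exists u v, [/\ A u, A v, divides_in A (u * x + v * y) x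
                & divides_in A (u * x + v * y) y].

(** Strong induction on the size of the divisor, that is, Euclid's algorithm.
    Elements of [A] are handled through codes in [T], so that the size need
    not be a function on the reals. *)
Lemma euclidean_bezout (T : Type) (val : T -> R) (size : T -> nat) :
    (forall x, A x <-> exists t, x = val t) ->
    (forall s t, val t != 0 -> exists q r,
       val s = val q * val t + val r /\ (val r = 0 \/ (size r < size t)%N)) ->
  bezout_in.
Proof.
move=> valP divP x y /valP[s ->] /valP[t ->] {x y}.
have Aval r : A (val r) by apply/valP; exists r.
have [n] := ubnP (size t); elim: n => // n IHn in s t * => le_tn.
have [t0|t_neq0] := eqVneq (val t) 0.
  exists 1, 0; rewrite t0 mulr0 addr0 mul1r.
  split; [exact: subring_set1|exact: subring_set0|exact: divides_in_refl|].
  exact: divides_in0.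
have [q [r [sE [r0|lt_rt]]]] := divP s t t_neq0.
  exists 0, 1; rewrite mul0r add0r mul1r sE r0 addr0.
  split; [exact: subring_set0|exact: subring_set1| |exact: divides_in_refl].
  by apply: divides_inM => //; apply: divides_in_refl.
have [|u [v [Au Av]]] := IHn t r; first exact: leq_trans lt_rt _.
have -> : u * val t + v * val r = v * val s + (u - v * val q) * val t.
  by rewrite sE; ring.
move=> gt gr; exists v, (u - v * val q); split=> //.
  by apply: subring_setB => //; apply: subring_setM.
by rewrite {2}sE; apply: divides_inD => //; apply: divides_inM.
Qed.

(** The form of Bezout's identity in which gcd's are used: as [c] ranges over
    all reals, it contains at once that [g] is a gcd, that gcd's commute with
    scaling, and that the quotients of the entries by [g] are coprime. *)
Lemma homogeneous_gcd (s : seq R) : bezout_in -> (forall x, x \in s -> A x) ->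
  exists g, [/\ A g, forall x, x \in s -> divides_in A g x
    & forall c d, (forall x, x \in s -> divides_in A d (c * x)) ->
        divides_in A d (c * g)].
Proof.
move=> bezA; elim: s => [|x s IHs] As.
  exists 0; split=> //; first exact: subring_set0.
  by move=> c d _; rewrite mulr0; apply: divides_in0.
have [y ys|g [Ag gs gP]] := IHs; first by apply: As; rewrite inE ys orbT.
have Ax : A x by apply: As; rewrite mem_head.
have [u [v [Au Av gx gg]]] := bezA x g Ax Ag.
exists (u * x + v * g); split.
- by apply: subring_setD; apply: subring_setM.
- move=> y; rewrite inE => /predU1P[-> //|/gs].
  exact: divides_in_trans gg.
- move=> c d dP; have -> : c * (u * x + v * g) = u * (c * x) + v * (c * g).
    by ring.
  apply: divides_inD; apply: divides_inM => //.
    by apply: dP; rewrite mem_head.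
  by apply: gP => y ys; apply: dP; rewrite inE ys orbT.
Qed.

End Divisibility.

(** * The rings of the Platonic solids *)

Section Zadjoin.
Variables (R : realType) (a b : R).

Lemma Zadjoin_subring : subring_set (Zadjoin a b).
Proof.
split=> [S [] //|x y Ax Ay S|x y Ax Ay S] subS aS bS.
  by case: (subS) => _ SB _; apply: SB; [apply: Ax|apply: Ay].
by case: (subS) => _ _ SM; apply: SM; [apply: Ax|apply: Ay].
Qed.

Lemma Zadjoinl : Zadjoin a b a. Proof. by move=> S. Qed.

Lemma Zadjoinr : Zadjoin a b b. Proof. by move=> S. Qed.

Lemma Zadjoin_min (A : set R) x :
  subring_set A -> A a -> A b -> Zadjoin a b x -> A x.
Proof.
move=> [A1 AB AM] Aa Ab /(_ (mem A)); rewrite !inE; apply=> //.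
split=> [|y z|y z]; rewrite !inE //; [exact: AB|exact: AM].
Qed.

End Zadjoin.

Lemma Zadjoin_int_bezout (R : realType) (m n : int) :
  bezout_in (Zadjoin (m%:~R : R) n%:~R).
Proof.
apply: (euclidean_bezout (Zadjoin_subring _ _)
  (val := fun z : int => z%:~R) (size := absz)) => [x|s t].
  split=> [|[z ->]]; last exact: (subring_set_int (Zadjoin_subring _ _)).
  apply: (Zadjoin_min (A := fun x => exists z : int, x = z%:~R));
    [|by exists m|by exists n].
  split; first by exists 1.
    by move=> _ _ [u ->] [v ->]; exists (u - v); rewrite rmorphB.
  by move=> _ _ [u ->] [v ->]; exists (u * v); rewrite rmorphM.
rewrite intr_eq0 => t_neq0; exists (s %/ t)%Z, (s %% t)%Z; split.
  by rewrite {1}(divz_eq s t) rmorphD rmorphM.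
by right; have := modz_ge0 s t_neq0; have := ltz_mod s t_neq0; lia.
Qed.

Definition golden_norm (x : int * int) : int :=
  x.1 ^+ 2 + x.1 * x.2 - x.2 ^+ 2.

(** Four times the norm is [(2 * m + n) ^ 2 - 5 * n ^ 2], and 5 is not a
    rational square. *)
Lemma golden_norm_eq0 x : golden_norm x = 0 -> x = (0, 0).
Proof.
case: x => m n; rewrite /golden_norm /= => normE.
have sqE : (`|(2 * m + n)%R| ^ 2 = 5 * `|n| ^ 2)%N.
  rewrite -!abszX -(abszM 5); congr absz.
  by rewrite -[RHS]addr0 -(mulr0 4) -normE; ring.
have [n0|n_gt0] := posnP `|n|%N.
  move: sqE; rewrite n0 muln0 => /eqP; rewrite expn_eq0 => ?.
  by congr pair; lia.
have := congr1 (logn 5) sqE.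
by rewrite lognM ?expn_gt0 ?n_gt0 // !lognX (_ : logn 5 5 = 1%N) //; lia.
Qed.

Lemma nearest_quotient (m d : int) : d != 0 ->
  exists q, 2 * `|m - d * q| <= `|d|.
Proof.
move=> d_neq0; have := modz_ge0 m d_neq0; have := ltz_mod m d_neq0.
have := divz_eq m d; set q := (m %/ d)%Z; set r := (m %% d)%Z => mE r_lt r_ge.
have [le_rd|lt_dr] := leP (2 * r) `|d|.
  by exists q; have -> : m - d * q = r by [rewrite mE; ring]; lia.
exists (q + Num.sg d).
have -> : m - d * (q + Num.sg d) = r - `|d| by rewrite normrEsg mE; ring.
lia.
Qed.

Section Golden.
Variables (R : realType) (w : R).
Hypothesis w_sq : w ^+ 2 = w + 1.

Let val (x : int * int) : R := x.1%:~R + x.2%:~R * w.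

(** Rounding both coordinates of [x / y] leaves an error whose coordinates are
    at most 1/2, hence of norm at most 1/2 in absolute value. *)
Lemma golden_division x y : val y != 0 -> exists q r,
  val x = val q * val y + val r /\
  (val r = 0 \/ (`|golden_norm r| < `|golden_norm y|)%N).
Proof.
case: x y => [a b] [m n] y_neq0; set N := golden_norm (m, n).
have N_neq0 : N != 0.
  apply: contraNneq y_neq0 => /golden_norm_eq0[-> ->].
  by rewrite /val mul0r addr0.
(* the coordinates of the product of x by the conjugate of y; their quotients
   by N are the coordinates of x / y *)
have [u uP] := nearest_quotient (a * m + a * n - b * n) N_neq0.
have [v vP] := nearest_quotient (b * m - a * n) N_neq0.
exists (u, v), (a - (u * m + v * n), b - (u * n + v * m + v * n)); split.
  rewrite /val /= !rmorphB !rmorphD !rmorphM /=.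
  by ring: w_sq.
right; move: uP vP.
set r1 := (X in `|X|); set r2 := (X in _ -> 2 * `|X| <= _ -> _).
set r := golden_norm _ => r1P r2P.
(* multiplicativity of the norm: N is also the norm of the conjugate of y *)
have rN : r * N = r1 ^+ 2 + r1 * r2 - r2 ^+ 2.
  by rewrite /r /N /r1 /r2 /N /golden_norm /=; ring.
suff : `|r| * `|N| < `|N| * `|N|.
  by rewrite ltr_pM2r ?normr_gt0 //; lia.
have half_sq (z : int) : 2 * `|z| <= `|N| -> 4 * z ^+ 2 <= N ^+ 2.
  move=> zP; rewrite -[z ^+ 2]real_normK ?num_real //.
  rewrite -[N ^+ 2]real_normK ?num_real //.
  rewrite (_ : 4 * _ = (2 * `|z|) ^+ 2); last by ring.
  by rewrite ler_sqr ?nnegrE ?mulr_ge0.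
have := half_sq _ r1P; have := half_sq _ r2P; have := sqr_ge0 (r1 - r2).
have := sqr_ge0 (r1 + r2); have : 0 < N ^+ 2 by rewrite exprn_even_gt0.
have -> : `|N| * `|N| = N ^+ 2 by rewrite -normrM -expr2 ger0_norm ?sqr_ge0.
rewrite -normrM rN ltr_norml; clear; clearbody N => N2_gt0 sD sB s2 s1.
by apply/andP; split; lra.
Qed.

Lemma Zadjoin_golden_bezout (a b : R) :
    (exists x, a = val x) -> (exists x, b = val x) -> Zadjoin a b w ->
  bezout_in (Zadjoin a b).
Proof.
move=> a_val b_val Aw; have subA := Zadjoin_subring a b.
apply: (euclidean_bezout subA (val := val)
  (size := fun x => absz (golden_norm x))).
  move=> x; split=> [|[[m n] ->]]; last first.
    apply: (subring_setD subA); first exact: subring_set_int.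
    by apply: (subring_setM subA) => //; apply: subring_set_int.
  apply: (Zadjoin_min (A := fun x => exists z, x = val z)) => //.
  split; first by exists (1, 0); rewrite /val mul0r addr0.
    move=> _ _ [[i j] ->] [[k l] ->]; exists (i - k, j - l).
    by rewrite /val /= !rmorphB /=; ring.
  move=> _ _ [[i j] ->] [[k l] ->].
  exists (i * k + j * l, i * l + j * k + j * l).
  by rewrite /val /= !rmorphD !rmorphM /=; ring: w_sq.
exact: golden_division.
Qed.

End Golden.

Section Omega.
Variable R : realType.

Lemma cos_two_pi_div_lt1 (n : nat) : (2 < n)%N -> cos (2 * pi / n%:R) < 1 :> R.
Proof.
move=> n_gt2; have pi0 := pi_gt0 R.
have n_gt2R : 2 < n%:R :> R by rewrite ltr_nat.
have x_gt0 : 0 < 2 * pi / n%:R :> R by rewrite !divr_gt0 ?mulr_gt0 //; lra.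
rewrite -[ltRHS]cos0 ltr_cos ?in_itv /= ?lexx ?(ltW x_gt0) ?(ltW pi0) //=.
by rewrite ler_pdivrMr; nra.
Qed.

(** The cosine of [x = 2 * pi / 3] satisfies [cos (2 * x) = cos x], a quadratic
    equation whose roots are 1 and -1/2. *)
Lemma omega3 : omega R 3 = 0.
Proof.
have := cos_two_pi_div_lt1 (n := 3) isT.
rewrite /omega; set x := 2 * pi / 3%:R => x_lt1.
have : cos (x *+ 2) = cos x.
  rewrite -[RHS]cosN -[RHS]cosD2pi; congr cos; by rewrite /x; field.
by rewrite cos_mulr2n; nra.
Qed.

Lemma omega4 : omega R 4 = 1.
Proof.
rewrite /omega (_ : 2 * pi / 4%:R = pi / 2); last by field.
by rewrite cos_pihalf mulr0 addr0.
Qed.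

(** With [x = 2 * pi / 5] one has [cos (3 * x) = cos (2 * x)], a cubic equation
    in [cos x]. Dividing out its root 1 leaves the equation of the golden
    ratio for [1 + 2 * cos x]. *)
Lemma omega5_sq : omega R 5 ^+ 2 = omega R 5 + 1.
Proof.
have := cos_two_pi_div_lt1 (n := 5) isT.
rewrite /omega; set x := 2 * pi / 5%:R => x_lt1.
have : cos (x *+ 2 + x) = cos (x *+ 2).
  rewrite -[RHS]cosN -[RHS]cosD2pi; congr cos; by rewrite /x; field.
have -> : cos (x *+ 2 + x) = 4 * cos x ^+ 3 - 3 * cos x.
  rewrite cosD cos_mulr2n sin_mulr2n.
  transitivity (cos x * (2 * cos x ^+ 2 - 1) - 2 * cos x * sin x ^+ 2).
    by ring.
  by rewrite sin2cos2; ring.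
rewrite cos_mulr2n => cubic.
have : (cos x - 1) * (4 * cos x ^+ 2 + 2 * cos x - 1) = 0 by lra.
by move/eqP; rewrite mulf_eq0 subr_eq0 lt_eqF //= => /eqP; lra.
Qed.

Lemma omega5_gt0 : 0 < omega R 5.
Proof.
have pi0 := pi_gt0 R.
have : 0 < cos (2 * pi / 5%:R : R) by apply: cos_gt0_pihalf; lra.
rewrite /omega; lra.
Qed.

End Omega.

(** * The parametrization *)

Lemma platonic_omega {R : realType} {p q : nat} : (p, q) \in platonic_solids ->
  [/\ bezout_in (@Zomega R p q), 0 < 1 + omega R p & 0 < 1 + omega R q].
Proof.
rewrite !inE /Zomega => /or4P[||| /orP[]] /eqP[-> ->];
  rewrite ?omega3 ?omega4; split;
  do ?[by have := omega5_gt0 R; lra].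
- by have := @Zadjoin_int_bezout R 0 0; rewrite ?mulr0z ?mulr1z.
- by have := @Zadjoin_int_bezout R 0 1; rewrite ?mulr0z ?mulr1z.
- by have := @Zadjoin_int_bezout R 1 0; rewrite ?mulr0z ?mulr1z.
- apply: (Zadjoin_golden_bezout (omega5_sq R));
    [exists (0, 0)|exists (0, 1)|exact: Zadjoinr]; rewrite /=; ring.
- apply: (Zadjoin_golden_bezout (omega5_sq R));
    [exists (0, 1)|exists (0, 0)|exact: Zadjoinl]; rewrite /=; ring.
Qed.

Section Parametrization.
Variables (R : realType) (p q : nat).
Local Notation A := (@Zomega R p q).
Local Notation wp := (omega R p).
Local Notation wq := (omega R q).

Let subA : subring_set A := Zadjoin_subring _ _.

(** The factor [k] is carried along so that the identity applies as it stands
    to [k / g * h]. *)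
Lemma Delta_h (k t1 t2 t3 : R) :
  Delta p q (k * h1 q t1 t2 t3) (k * h2 q t1 t2 t3) (k * h3 p q t1 t2 t3) =
  (k * h0 q t1 t2 t3) ^+ 2.
Proof. by rewrite /Delta /h0 /h1 /h2 /h3; ring. Qed.

Lemma given_by_integrality (b1 b2 b3 t1 t2 t3 k g : R) :
  given_by p q b1 b2 b3 t1 t2 t3 k g -> integrality p q b1 b2 b3.
Proof.
case=> _ Ak [_ gh _] [-> -> ->].
have quotA x : divides_in A g x -> A (k / g * x).
  case=> y Ay ->; have [->|g_neq0] := eqVneq g 0.
    by rewrite mul0r mulr0; apply: (subring_set0 subA).
  by rewrite mulrA divfK //; apply: (subring_setM subA).
have quot_h x : x \in [:: h0 q t1 t2 t3; h1 q t1 t2 t3; h2 q t1 t2 t3;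
  h3 p q t1 t2 t3] -> A (k / g * x) by move/gh/quotA.
rewrite /integrality Delta_h sqrtr_sqr sqr_ge0.
split=> //; do ?[by apply: quot_h; rewrite !inE eqxx ?orbT].
have : A (k / g * h0 q t1 t2 t3) by apply: quot_h; rewrite mem_head.
by case: ger0P => // _; apply: (subring_setN subA).
Qed.

Hypothesis bezA : bezout_in A.

Lemma given_by_degenerate (b3 : R) : A b3 -> given_by p q 0 0 b3 1 0 0 b3 1.
Proof.
move=> Ab; have [A0 A1] := (subring_set0 subA, subring_set1 subA).
have hE : [/\ h0 q 1 0 0 = 0 :> R, h1 q 1 0 0 = 0 :> R, h2 q 1 0 0 = 0 :> R
  & h3 p q 1 0 0 = 1 :> R] by rewrite /h0 /h1 /h2 /h3; split; ring.
rewrite /given_by; case: hE => -> -> -> ->.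
split=> //; last by rewrite divr1 !mulr0 mulr1.
- split=> //; split=> // [x|d _ dP]; last by apply: dP; rewrite mem_head.
  by rewrite !inE => /or3P[] /eqP ->; apply: divides_in1.
- split=> // [x|d _ dP]; last by apply: dP; rewrite !inE eqxx !orbT.
  by rewrite !inE => /or4P[] /eqP ->; apply: divides_in1.
Qed.

(** Here [t = (d, b1, b2) / e], [k = gcd (d, b1, b2, b3)] and [g = lam * k],
    with [d] the root of [Delta]. That [k] divides the [b_i] is recorded
    because it makes [k] a unit when the [b_i] are coprime. *)
Lemma integrality_given_by (b1 b2 b3 : R) : b1 + b2 != 0 -> 1 + wq != 0 ->
    integrality p q b1 b2 b3 ->
  exists t1 t2 t3 k g : R, [/\ given_by p q b1 b2 b3 t1 t2 t3 k g,
    divides_in A k b1, divides_in A k b2 & divides_in A k b3].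
Proof.
move=> b12_neq0 c_neq0 [Ab1 Ab2 Ab3 Delta_ge0 Ad].
have := sqr_sqrtr Delta_ge0; set d := Num.sqrt _ in Ad * => d_sq.
have [x|e [Ae es eP]] := homogeneous_gcd subA (s := [:: d; b1; b2]) bezA.
  by rewrite !inE => /or3P[] /eqP ->.
have [x|k [Ak ks kP]] := homogeneous_gcd subA (s := [:: d; b1; b2; b3]) bezA.
  by rewrite !inE => /or4P[] /eqP ->.
have [t1 At1 dE] : divides_in A e d by apply: es; rewrite mem_head.
have [t2 At2 b1E] : divides_in A e b1 by apply: es; rewrite !inE eqxx ?orbT.
have [t3 At3 b2E] : divides_in A e b2 by apply: es; rewrite !inE eqxx ?orbT.
have kb1 : divides_in A k b1 by apply: ks; rewrite !inE eqxx ?orbT.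
have kb2 : divides_in A k b2 by apply: ks; rewrite !inE eqxx ?orbT.
have kb3 : divides_in A k b3 by apply: ks; rewrite !inE eqxx ?orbT.
have e_neq0 : e != 0.
  by apply: contraNneq b12_neq0 => e0; rewrite b1E b2E e0 !mul0r addr0.
have k_neq0 : k != 0.
  apply: contraNneq b12_neq0 => k0.
  by case: kb1 kb2 => [u _ ->] [v _ ->]; rewrite k0 !mul0r addr0.
pose lam := (1 + wq) * (b1 + b2) / e ^+ 2.
have lam_neq0 : lam != 0 by rewrite !mulf_neq0 ?invr_neq0 ?expf_neq0.
have h0E : h0 q t1 t2 t3 = lam * d.
  by rewrite /h0 /lam dE b1E b2E; field.
have h1E : h1 q t1 t2 t3 = lam * b1.
  by rewrite /h1 /lam b1E b2E; field.
have h2E : h2 q t1 t2 t3 = lam * b2.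
  by rewrite /h2 /lam b1E b2E; field.
have h3E : h3 p q t1 t2 t3 = lam * b3.
  have -> : h3 p q t1 t2 t3 =
      (d ^+ 2 - (1 + wq) * (b1 - wp * b2) * b2) / e ^+ 2.
    by rewrite /h3 dE b1E b2E; field.
  by rewrite d_sq /Delta /lam; field.
(* lam itself may fail to be in A, but its multiples by d and the b_i are the
   h_i, and this puts lam * k in A *)
have Awp : A wp by apply: Zadjoinl.
have Ac : A (1 + wq).
  by apply: (subring_setD subA); [exact: (subring_set1 subA)|exact: Zadjoinr].
have As : A ((1 + wq) * (t2 + t3)).
  by apply: (subring_setM subA) => //; apply: (subring_setD subA).
have hA x : x \in [:: d; b1; b2; b3] -> A (lam * x).
  have Ah3 : A (h3 p q t1 t2 t3).
    apply: (subring_setB subA); rewrite ?expr2;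
      do ?apply: (subring_setM subA) => //.
    by apply: (subring_setB subA) => //; apply: (subring_setM subA).
  rewrite !inE => /or4P[] /eqP ->; rewrite -?h0E -?h1E -?h2E -?h3E //;
    by apply: (subring_setM subA).
exists t1, t2, t3, k, (lam * k); split=> //; split=> //.
- split=> //; split=> [|x|f _ fP]; first exact: (subring_set1 subA).
    by rewrite !inE => /or3P[] /eqP ->; apply: divides_in1.
  (* the property of e scaled by 1 / e says that t is coprime *)
  rewrite -(mulVf e_neq0); apply: eP => x.
  by rewrite !inE => /or3P[] /eqP ->; rewrite ?dE ?b1E ?b2E mulKf //;
     apply: fP; rewrite !inE eqxx ?orbT.
- rewrite h0E h1E h2E h3E; split.
  + apply: (divides_in_closed subA (d := 1)); first exact: (subring_set1 subA).
    by apply: kP => x /hA /divides_in1.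
  + move=> x; rewrite !inE => /or4P[] /eqP ->; apply: divides_in_mul2l;
      by apply: ks; rewrite !inE eqxx ?orbT.
  + move=> f _ fP; apply: kP => x.
    by rewrite !inE => /or4P[] /eqP ->; apply: fP; rewrite !inE eqxx ?orbT.
- by rewrite h1E h2E h3E; split; field; rewrite k_neq0 lam_neq0.
Qed.

End Parametrization.

Theorem corollary6 (R : realType) (p q : nat)
    (hpq : (p, q) \in platonic_solids) (b1 b2 b3 : R) :
  (integrality p q b1 b2 b3 <->
     exists t1 t2 t3 k g : R, given_by p q b1 b2 b3 t1 t2 t3 k g) /\
  (coprime_in (Zomega p q) [:: b1; b2; b3] ->
     (integrality p q b1 b2 b3 <->
        exists t1 t2 t3 k g : R,
          given_by p q b1 b2 b3 t1 t2 t3 k g /\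
          coprime_in (Zomega p q) [:: k; g])).
Proof.
have [bezA wp_gt0 wq_gt0] := platonic_omega (R := R) hpq.
have subA : subring_set (Zomega p q) :=
  Zadjoin_subring (omega R p) (omega R q).
have key : integrality p q b1 b2 b3 -> exists t1 t2 t3 k g : R,
    given_by p q b1 b2 b3 t1 t2 t3 k g /\
    (coprime_in (Zomega p q) [:: b1; b2; b3] ->
     coprime_in (Zomega p q) [:: k; g]).
  move=> intb; have [b120|b12_neq0] := eqVneq (b1 + b2) 0.
    have b1E : b1 = - b2 by lra.
    have b20 : b2 = 0.
      apply/eqP; rewrite -sqrf_eq0; case: intb => _ _ _ + _.
      have -> : Delta p q b1 b2 b3 =
          - ((1 + omega R q) * (1 + omega R p) * b2 ^+ 2).
        by rewrite /Delta b1E; ring.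
      rewrite oppr_ge0 pmulr_rle0 ?mulr_gt0 // => b2_le0.
      by rewrite eq_le b2_le0 sqr_ge0.
    move: intb; rewrite b1E b20 oppr0 => intb.
    have Ab3 : Zomega p q b3 by case: intb.
    exists 1, 0, 0, b3, 1; split; first exact: given_by_degenerate.
    move=> _; split=> [|x|d _ dP]; first exact: (subring_set1 subA).
      by rewrite !inE => /orP[] /eqP ->; apply: divides_in1 => //;
         apply: (subring_set1 subA).
    by apply: dP; rewrite !inE eqxx orbT.
  have [|t1 [t2 [t3 [k [g [gb kb1 kb2 kb3]]]]]] :=
    integrality_given_by bezA b12_neq0 _ intb.
    by rewrite gt_eqF.
  exists t1, t2, t3, k, g; split=> // -[_ _ bP].
  have [_ Ak [Ag _ _] _] := gb.
  split=> [|x|d Ad dP]; first exact: (subring_set1 subA).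
    by rewrite !inE => /orP[] /eqP ->; apply: divides_in1.
  apply: (divides_in_trans subA (x := k)); first by apply: dP; rewrite mem_head.
  by apply: bP => // x; rewrite !inE => /or3P[] /eqP ->.
split=> [|cop]; split.
- by move/key => [t1 [t2 [t3 [k [g [gb _]]]]]]; exists t1, t2, t3, k, g.
- by move=> [t1 [t2 [t3 [k [g]]]]]; apply: given_by_integrality.
- move/key => [t1 [t2 [t3 [k [g [gb kg]]]]]]; exists t1, t2, t3, k, g.
  by split=> //; apply: kg.
- by move=> [t1 [t2 [t3 [k [g [gb _]]]]]]; apply: given_by_integrality gb.
Qed.
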